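(* For every fixed $p\ge 5$ we have $g(n,K_p|\langle C_p\rangle)\le\left\lfloor\frac{p-3}{2}\,n\right\rfloor+1$ for all $n\ge 2p-5$. Moreover, the equality $g(n,K_p|\langle C_p\rangle)=\left\lfloor\frac{p-3}{2}\,n\right\rfloor+1$ is valid for every sufficiently large $n>n_0(p)$.
   Context: $C_p$ is the cycle on $p$ vertices. For a graph $F$, $\langle F\rangle$ is the family of all graphs containing $F$ as a subgraph (not necessarily induced). In an edge coloring of $K_n$ (not necessarily proper), for a copy $G'\subseteq K_n$ of a graph $G$, a color class of $G'$ is the graph formed by all edges of $G'$ having a given color that occurs in $G'$. For a family $\mathcal{F}$ of graphs with $K_2\notin\mathcal{F}$ and $n\ge|G|$, $g(n,G|\mathcal{F})$ is the largest integer $m$ for which there exists an edge coloring of $K_n$ using exactly $m$ colors such that every copy of $G$ contains a color class which is a member of $\mathcal{F}$; if no such coloring exists, then $g(n,G|\mathcal{F}):=0$. *)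

(* Defs.v *)
From mathcomp Require Import all_boot.

Set Implicit Arguments.
Unset Strict Implicit.
Unset Printing Implicit Defensive.

Record sgraph := SGraph {
  svertex :> finType;
  sedge : rel svertex;
  sedge_sym : symmetric sedge;
  sedge_irrefl : irreflexive sedge
}.

Definition edges (G : sgraph) : {set {set G}} :=
  [set [set uv.1; uv.2] | uv : G * G & sedge uv.1 uv.2].

Definition complete_rel n : rel 'I_n := [rel x y | x != y].

Lemma complete_rel_sym n : symmetric (@complete_rel n).
Proof. by move=> x y; rewrite /complete_rel /= eq_sym. Qed.

Lemma complete_rel_irrefl n : irreflexive (@complete_rel n).
Proof. by move=> x; rewrite /complete_rel /= eqxx. Qed.

Definition complete n : sgraph :=
  SGraph (@complete_rel_sym n) (@complete_rel_irrefl n).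

(* This is the cycle only for 3 <= n; the conjunct x != y makes the relation
   irreflexive in the degenerate case n = 1. *)
Definition cycle_rel n : rel 'I_n :=
  [rel x y : 'I_n | (x != y) && ((y == x.+1 %% n :> nat) || (x == y.+1 %% n :> nat))].

Lemma cycle_rel_sym n : symmetric (@cycle_rel n).
Proof. by move=> x y; rewrite /cycle_rel /= eq_sym orbC. Qed.

Lemma cycle_rel_irrefl n : irreflexive (@cycle_rel n).
Proof. by move=> x; rewrite /cycle_rel /= eqxx. Qed.

Definition cycle_graph n : sgraph :=
  SGraph (@cycle_rel_sym n) (@cycle_rel_irrefl n).

Definition subgraph (F H : sgraph) : bool :=
  [exists h : {ffun F -> H},
     injectiveb h && [forall x, forall y, sedge x y ==> sedge (h x) (h y)]].

Definition supergraphs (F : sgraph) : pred sgraph := fun H => subgraph F H.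

(* Colorings are not required to be proper; a coloring with exactly m colors
   is a surjective one. *)
Definition coloring (n m : nat) :=
  {ffun {e : {set complete n} | e \in edges (complete n)} -> 'I_m}.

Definition uses_all_colors n m (c : coloring n m) : bool :=
  [forall k, exists e, c e == k].

(* A copy of G in K_n is given by an injection f of the vertices of G into
   those of K_n; its edges are the images of the edges of G. *)
Definition copy_edges (G : sgraph) n (f : {ffun G -> complete n}) :
    {set {set complete n}} :=
  [set f @: e | e : {set G} in edges G].

Section ColorClass.
Variables (G : sgraph) (n m : nat) (c : coloring n m).
Variables (f : {ffun G -> complete n}) (k : 'I_m).

Definition color_occurs : bool :=
  [exists e, (val e \in copy_edges f) && (c e == k)].

Definition class_adj : rel (complete n) := [rel x y |
  [exists e, [&& val e == [set x; y], val e \in copy_edges f & c e == k]]].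

(* The class is formed by edges, so its vertices are the ends of these. *)
Definition class_vertex := {x : complete n | [exists y, class_adj x y]}.

Definition class_rel : rel class_vertex :=
  [rel x y | class_adj (val x) (val y)].

Lemma class_rel_sym : symmetric class_rel.
Proof.
by move=> x y; apply: eq_existsb => e; rewrite /= setUC.
Qed.

Lemma class_rel_irrefl : irreflexive class_rel.
Proof.
move=> x; apply/negbTE/negP=> /existsP[[e e_edge]] /and3P[/eqP /= e_x _ _].
have /imsetP[[u v]] := e_edge.
rewrite inE /complete_rel /= => uv e_uv.
by have := cards2 u v; rewrite -e_uv e_x setUid cards1 (uv : u != v).
Qed.

Definition color_class : sgraph := SGraph class_rel_sym class_rel_irrefl.

End ColorClass.

Definition good_coloring (n m : nat) (G : sgraph) (F : pred sgraph)
    (c : coloring n m) : bool :=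
  [forall f : {ffun G -> complete n}, injectiveb f ==>
     [exists k, color_occurs c f k && F (color_class c f k)]].

Definition attainable (n : nat) (G : sgraph) (F : pred sgraph) (m : nat) : bool :=
  [exists c : coloring n m, uses_all_colors c && good_coloring G F c].

(* The range loses nothing, as K_n has no more colors than edges, and the
   maximum over an empty range is 0; see gcol_ge and gcol_attainable. *)
Definition gcol (n : nat) (G : sgraph) (F : pred sgraph) : nat :=
  \max_(m < #|edges (complete n)|.+1 | attainable n G F m) m.

Lemma attainable_le n G F m :
  attainable n G F m -> m <= #|edges (complete n)|.
Proof.
case/existsP=> c /andP[/forallP sc _].
have sur (k : 'I_m) : {e | c e == k} by apply: sigW; apply/existsP.
have inj : injective (fun k => sval (sur k)).
  move=> k l E; rewrite -(eqP (svalP (sur k))) -(eqP (svalP (sur l))).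
  by congr (c _).
by have := leq_card _ inj; rewrite card_ord card_sig.
Qed.

Lemma gcol_ge n G F m : attainable n G F m -> m <= gcol n G F.
Proof.
move=> Pm; have lt_m : m < #|edges (complete n)|.+1.
  exact: attainable_le Pm.
exact: (@leq_bigmax_cond _ _ (@nat_of_ord _) (Ordinal lt_m) Pm).
Qed.

Lemma gcol_attainable n G F m :
  attainable n G F m -> attainable n G F (gcol n G F).
Proof.
move=> Pm; have lt_m : m < #|edges (complete n)|.+1.
  exact: attainable_le Pm.
rewrite /gcol (bigmax_eq_arg (Ordinal lt_m)) //.
by case: arg_maxnP.
Qed.

(* Main.v *)
Require Import Defs.
From mathcomp Require Import all_boot.
From mathcomp Require Import zify.

Set Implicit Arguments.
Unset Strict Implicit.
Unset Printing Implicit Defensive.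

(** Call a coloring good if every p-set of vertices carries a monochromatic
    Hamiltonian cycle of its complete graph.

    Upper bound.  In a good coloring a vertex v sees at most p - 2 colors: with
    p - 1 neighbors joined to v in different colors, v would have no two edges
    of the same color in the p-set that they form with v ([palette_le]).  If v
    sees exactly p - 2 colors and n >= p, then some color a is repeated at v.
    Take two edges of color a and one edge of each other color at v, choosing
    them so that a given vertex w is among the ends: the monochromatic cycle
    must have color a, so w sees a as well.  Hence a is seen everywhere
    ([full_palette_spanning]).  Count the pairs (vertex, color seen by it).
    Every color is seen by at least 2 vertices.  With a spanning color,
    2 (m - 1) + n <= (p - 2) n; if instead all vertices see at most p - 3
    colors, 2 m <= (p - 3) n.  Both give the bound ([attainable_cycle_le]).

    Lower bound.  Put d = p - 3.  It suffices to find a graph H on n vertices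
    with at least the integer part of d n / 2 edges such that, for each p-set
    P, the complement of H on P is Hamiltonian: color H with pairwise distinct
    colors and all other edges with one more color.  Let H be the circulant
    graph on the integers mod n in which x and y are joined when they are at
    an odd distance at most d, where for odd d the edges of length 1 are
    thinned out to a matching.

    When n is large, P misses an arc of d consecutive vertices.  Cutting the
    circle there puts P on a line ([cut]), on which H joins only positions of
    different parity.  So the complement of H on P is covered by two cliques,
    and such a graph is Hamiltonian as soon as it is 2-connected
    ([two_cliques_hamiltonian]).  Since P has d + 3 vertices, this asks for
    the following: d + 2 positions, even and odd ones both occurring, are
    never completely joined between the parities ([circulant_cross]).  Indeed,
    if all differences between even and odd positions are at most d, then
    comparing the extreme positions shows that there are at most d + 2 of
    them, and that d + 2 is reached only for odd d and only with three
    consecutive positions ([opposite_parity_close]); their two edges of length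
    1 share a vertex, which the matching forbids. *)

(** * The upper bound *)

Definition kedge n m (c : coloring n m) (k : 'I_m) : rel 'I_n :=
  fun x y => [exists e, (val e == [set x; y]) && (c e == k)].

Lemma edge_complete n (x y : complete n) :
  x != y -> [set x; y] \in edges (complete n).
Proof. by move=> xy; apply/imsetP; exists (x, y); rewrite ?inE. Qed.

Lemma card_edge n (e : {set complete n}) : e \in edges (complete n) -> #|e| = 2.
Proof.
by case/imsetP=> [[x y]]; rewrite inE /= => xy ->; rewrite cards2 (xy : x != y).
Qed.

Lemma kedge_neq n m (c : coloring n m) k x y : kedge c k x y -> x != y.
Proof.
case/existsP=> -[e he] /andP[/eqP /= E _].
by have := card_edge he; rewrite E cards2; case: (x != y).
Qed.

Lemma kedge_sym n m (c : coloring n m) k : symmetric (kedge c k).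
Proof. by move=> x y; apply: eq_existsb => e; rewrite setUC. Qed.

Lemma kedge_inj n m (c : coloring n m) k l x y :
  kedge c k x y -> kedge c l x y -> k = l.
Proof.
case/existsP=> e /andP[/eqP E /eqP <-] /existsP[e' /andP[/eqP E' /eqP <-]].
by congr (c _); apply: val_inj; rewrite E E'.
Qed.

Lemma kedge_total n m (c : coloring n m) x y :
  x != y -> exists k, kedge c k x y.
Proof.
move=> xy; exists (c (exist _ [set x; y] (edge_complete xy))); apply/existsP.
by exists (exist _ [set x; y] (edge_complete xy)); rewrite !eqxx.
Qed.

Lemma modnS_small i p : i < p -> i.+1 %% p = if i.+1 == p then 0 else i.+1.
Proof. by move=> ip; case: eqP => [->|?]; rewrite ?modnn ?modn_small //; lia. Qed.

Lemma ordS_neq p (i : 'I_p) : 1 < p -> i != ordS i.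
Proof.
move=> p1; apply/eqP => /(congr1 val) /=; have ip := ltn_ord i.
by rewrite modnS_small //; case: eqP; lia.
Qed.

(** All that the upper bound uses of a monochromatic Hamiltonian cycle of P is
    that each vertex of P has two neighbors in P along it. *)
Lemma mono_cycle_nbrs n m p (c : coloring n m) (P : {set 'I_n}) :
  3 <= p -> good_coloring (complete p) (supergraphs (cycle_graph p)) c ->
  #|P| = p ->
  exists k, forall x, x \in P -> exists y z,
    [/\ y \in P, z \in P, y != z, kedge c k x y & kedge c k x z].
Proof.
move=> p3 /forallP good cP.
pose f : {ffun complete p -> complete n} :=
  [ffun i : 'I_p => enum_val (cast_ord (esym cP) i)].
have f_inj : injective f.
  by move=> i j; rewrite !ffunE => /enum_val_inj/cast_ord_inj.
have fP i : f i \in P by rewrite ffunE; apply: enum_valP.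
have := good f; rewrite (introT (injectiveP _) f_inj) /=.
case/existsP=> k /andP[_ /existsP[h /andP[/injectiveP h_inj /forallP h_adj]]].
exists k.
have cyc (i j : 'I_p) : cycle_rel i j ->
    [/\ val (h i) \in P, val (h j) \in P & kedge c k (val (h i)) (val (h j))].
  move=> ij; have /implyP/(_ ij) := forallP (h_adj i) j.
  case/existsP=> e /and3P[/eqP E eC ek].
  have sub x : x \in val e -> x \in P.
    by case/imsetP: eC => e' _ -> /imsetP[j' _ ->].
  split; try by apply: sub; rewrite E !inE eqxx ?orbT.
  by apply/existsP; exists e; rewrite E eqxx.
have nS (i : 'I_p) : cycle_rel i (ordS i).
  by rewrite /cycle_rel /= eqxx andbT ordS_neq //; lia.
have nP (i : 'I_p) : cycle_rel i (ord_pred i).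
  by rewrite -{1}[i]ord_predK cycle_rel_sym nS.
pose g (i : 'I_p) : 'I_n := val (h i).
have g_inj : injective g by move=> i j /val_inj/h_inj.
(* The cycle lies in P and has as many vertices as P, so it visits all of P. *)
have gP : g @: setT = P.
  apply/eqP; rewrite eqEcard card_imset // cardsT card_ord cP leqnn andbT.
  by apply/subsetP=> _ /imsetP[i _ ->]; have [] := cyc _ _ (nS i).
move=> x; rewrite -{1}gP => /imsetP[i _ ->].
have [_ P1 K1] := cyc _ _ (nS i); have [_ P2 K2] := cyc _ _ (nP i).
exists (g (ordS i)), (g (ord_pred i)); split=> //.
apply/eqP => /g_inj /(congr1 (@ordS p)); rewrite ord_predK => /(congr1 val) /=.
have ip := ltn_ord i; rewrite (modnS_small ip) modnS_small; last by case: eqP; lia.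
by do !case: eqP; lia.
Qed.

Definition palette n m (c : coloring n m) (v : 'I_n) : {set 'I_m} :=
  [set k | [exists w, kedge c k v w]].

Lemma paletteP n m (c : coloring n m) v k :
  reflect (exists w, kedge c k v w) (k \in palette c v).
Proof. by rewrite inE; apply: existsP. Qed.

Lemma palette_rep n m (c : coloring n m) v :
  exists g : 'I_m -> 'I_n, forall k, k \in palette c v -> kedge c k v (g k).
Proof.
exists (fun k => odflt v [pick w | kedge c k v w]) => k /paletteP[w vw].
by case: pickP => [w' //|/(_ w)]; rewrite vw.
Qed.

(** One neighbor per color for p - 1 colors, together with v, would form a
    p-set in which no color is repeated at v. *)
Lemma palette_le n m p (c : coloring n m) v :
  3 <= p -> good_coloring (complete p) (supergraphs (cycle_graph p)) c ->
  #|palette c v| <= p - 2.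
Proof.
move=> p3 good; rewrite leqNgt; apply/negP => big.
have [g gP] := palette_rep c v.
have /card_geqP[s [us ss sub]] : p - 1 <= #|palette c v| by lia.
pose K := [set k in s].
have KP k : k \in K -> kedge c k v (g k) by rewrite inE => ks; apply: gP; apply: sub.
have cK : #|K| = p - 1 by rewrite cardsE (card_uniqP us).
have g_inj : {in K &, injective g}.
  by move=> k l /KP vk /KP vl E; rewrite E in vk; apply: kedge_inj vk vl.
have [] := @mono_cycle_nbrs _ _ p c (v |: g @: K) p3 good.
  rewrite cardsU1 card_in_imset // cK.
  case: imsetP => [[k /KP/kedge_neq + E]|_]; last by lia.
  by rewrite {1}E eqxx.
move=> k /(_ v (setU11 _ _))[y [z []]]; rewrite !in_setU1 => yP zP yz vy vz.
move: yP zP; rewrite ![_ == v]eq_sym (negbTE (kedge_neq vy)) (negbTE (kedge_neq vz)) /=.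
case/imsetP=> l /KP vl yE /imsetP[l' /KP vl' zE]; subst.
by move: yz; rewrite (kedge_inj vl vy) (kedge_inj vl' vz) eqxx.
Qed.

(** The color of any edge v w0 beyond one representative g k per color k is
    repeated at v, and it is spanning: a representative can be exchanged for
    an arbitrary vertex w, and v, w0 and the representatives form a p-set whose
    monochromatic cycle can only pass through v in that repeated color. *)
Lemma full_palette_spanning n m p (c : coloring n m) v :
  3 <= p -> p <= n ->
  good_coloring (complete p) (supergraphs (cycle_graph p)) c ->
  #|palette c v| = p - 2 -> exists a, forall w, a \in palette c w.
Proof.
move=> p3 pn good full.
have [g gP] := palette_rep c v.
have [w0] : exists w0, w0 \notin v |: g @: palette c v.
  apply/existsP; rewrite -negb_forall; apply/negP => /forallP all.
  have: #|v |: g @: palette c v| = n.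
    by rewrite -[RHS]card_ord; apply: eq_card => x; rewrite all inE.
  have : #|g @: palette c v| <= p - 2 by rewrite -full leq_imset_card.
  rewrite cardsU1 => le E; have : n <= 1 + (p - 2); last by lia.
  by rewrite -E; apply: leq_add le; apply: leq_b1.
rewrite in_setU1 negb_or eq_sym => /andP[vw0 w0g].
have [a va] := kedge_total c vw0.
exists a => w; have [<-|vw] := eqVneq v w; first by apply/paletteP; exists w0.
have [b vb] := kedge_total c vw.
have [ab|ba] := eqVneq b a.
  by apply/paletteP; exists v; rewrite kedge_sym -ab.
pose h k := if k == b then w else g k.
have hP k : k \in palette c v -> kedge c k v (h k).
  by rewrite /h; case: eqP => [-> //|_]; apply: gP.
have h_inj : {in palette c v &, injective h}.
  by move=> k l /hP vk /hP vl E; rewrite E in vk; apply: kedge_inj vk vl.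
have w0h : w0 \notin h @: palette c v.
  apply/imsetP => -[k kv]; rewrite /h; case: eqP => [_ E|_ E].
    by move: ba; rewrite (kedge_inj vb (l := a)) ?eqxx // -E.
  by case/negP: w0g; rewrite E imset_f.
have vh : v \notin h @: palette c v.
  by apply/imsetP => -[k /hP/kedge_neq + E]; rewrite {1}E eqxx.
have [] := @mono_cycle_nbrs _ _ p c (v |: (w0 |: h @: palette c v)) p3 good.
  by rewrite !cardsU1 in_setU1 negb_or vw0 vh w0h card_in_imset // full; lia.
move=> k kP.
(* Two edges at v of the same color k: one of them must be v w0, as the
   representatives carry distinct colors. *)
have ka : k = a.
  have [y [z []]] := kP v (setU11 _ _); rewrite !in_setU1 => yP zP yz vy vz; move: yP zP.
  rewrite ![_ == v]eq_sym (negbTE (kedge_neq vy)) (negbTE (kedge_neq vz)) /=.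
  case/predU1P=> [E _|yh]; first by apply: kedge_inj vy _; rewrite E.
  case/predU1P=> [E|zh]; first by apply: kedge_inj vz _; rewrite E.
  case/imsetP: yh => l /hP vl yE; case/imsetP: zh => l' /hP vl' zE; subst.
  by move: yz; rewrite (kedge_inj vl vy) (kedge_inj vl' vz) eqxx.
subst k; have [] := kP w; last by move=> y [z [_ _ _ wy _]]; apply/paletteP; exists y.
rewrite !inE; apply/orP; right; apply/orP; right.
apply/imsetP; exists b; first by apply/paletteP; exists w.
by rewrite /h eqxx.
Qed.

Lemma sum_palette n m (c : coloring n m) :
  \sum_(v : 'I_n) #|palette c v| = \sum_k #|[set v | k \in palette c v]|.
Proof.
under eq_bigr do rewrite -sum1_card big_mkcond /=.
rewrite exchange_big /=; apply: eq_bigr => k _.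
by rewrite -sum1_card big_mkcond /=; apply: eq_bigr => v _; rewrite [in RHS]inE.
Qed.

Lemma used_color_card n m (c : coloring n m) k :
  uses_all_colors c -> 2 <= #|[set v | k \in palette c v]|.
Proof.
move=> /forallP/(_ k)/existsP[e ek].
have [[x y]] := imsetP (valP e); rewrite inE /= => xy E.
have kxy : kedge c k x y.
  by apply/existsP; exists e; apply/andP; split=> //; apply/eqP; exact: E.
have <- : #|[set x; y]| = 2 by rewrite cards2 (xy : x != y).
apply/subset_leq_card/subsetP=> z; rewrite !inE => /orP[] /eqP->.
  by apply/existsP; exists y.
by apply/existsP; exists x; rewrite kedge_sym.
Qed.

Lemma attainable_cycle_le n m p :
  3 <= p -> p <= n ->
  attainable n (complete p) (supergraphs (cycle_graph p)) m ->
  m <= ((p - 3) * n) %/ 2 + 1.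
Proof.
move=> p3 pn /existsP[c /andP[used good]].
have le v := palette_le v p3 good.
have [v /eqP full|small] := pickP (fun v => #|palette c v| == p - 2).
  have [a aP] := full_palette_spanning p3 pn good full.
  have lo : n + (m - 1) * 2 <= \sum_(v : 'I_n) #|palette c v|.
    rewrite sum_palette (bigD1 a) //=.
    have -> : #|[set v | a \in palette c v]| = n.
      by rewrite -[RHS]card_ord; apply: eq_card => x; rewrite inE aP.
    have -> : (m - 1) * 2 = \sum_(k < m | k != a) 2.
      have := cardC1 a; rewrite sum_nat_const card_ord => E.
      by congr (_ * _); rewrite subn1 -E.
    by rewrite leq_add2l; apply: leq_sum => k _; apply: used_color_card.
  have hi : \sum_(v : 'I_n) #|palette c v| <= n + (p - 3) * n.
    have -> : n + (p - 3) * n = \sum_(v < n) (p - 2).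
      by rewrite sum_nat_const card_ord -mulSn mulnC; congr (_ * _); lia.
    by apply: leq_sum.
  by have := leq_trans lo hi; set q := _ * n; lia.
have lo : m * 2 <= \sum_(v : 'I_n) #|palette c v|.
  have -> : m * 2 = \sum_(k < m) 2 by rewrite sum_nat_const card_ord.
  rewrite sum_palette.
  by apply: leq_sum => k _; apply: used_color_card.
have hi : \sum_(v : 'I_n) #|palette c v| <= (p - 3) * n.
  have -> : (p - 3) * n = \sum_(v < n) (p - 3).
    by rewrite sum_nat_const card_ord mulnC.
  by apply: leq_sum => v _; have := le v; have := small v; lia.
by have := leq_trans lo hi; set q := _ * n; lia.
Qed.

(** * Graphs covered by two cliques *)

(** The hypothesis on cardinals says that a and b coincide exactly when they
    have to, so that one statement serves one-vertex cliques as well. *)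
Lemma clique_path (T : finType) (R : rel T) (A : {set T}) a b :
  {in A &, forall x y, x != y -> R x y} -> a \in A -> b \in A ->
  (a == b) = (#|A| == 1) ->
  exists s, [/\ uniq (a :: s), a :: s =i A, path R a s & last a s = b].
Proof.
move=> clique aA bA; have [<-|ab] := eqVneq a b.
  move=> /esym/cards1P[x Ax]; exists [::]; split=> // y.
  by move: aA; rewrite Ax !inE => /eqP->.
move=> _; exists (rcons (enum (A :\ a :\ b)) b).
have us : uniq (a :: rcons (enum (A :\ a :\ b)) b).
  rewrite /= mem_rcons inE negb_or ab mem_enum rcons_uniq mem_enum enum_uniq.
  by rewrite !inE !eqxx ?andbF.
have es : a :: rcons (enum (A :\ a :\ b)) b =i A.
  move=> x; rewrite inE mem_rcons inE mem_enum !inE.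
  case: (eqVneq x a) => [->|_]; first by rewrite aA.
  by case: (eqVneq x b) => [->|_]; rewrite ?bA //= andbT.
split=> //; last by rewrite last_rcons.
have := us; rewrite uniq_pairwise => neq.
apply: (@pairwise_sorted _ R (a :: _)); move: neq.
apply: (@sub_in_pairwise _ (mem A)); last by apply/allP=> x; rewrite es.
by move=> x y xA yA; apply: clique.
Qed.

(** Traverse A from a1 to a2, cross to b2, traverse B back to b1 and close the
    cycle with the edge between b1 and a1. *)
Lemma link_two_cliques (T : finType) (R : rel T) (A B : {set T}) a1 a2 b1 b2 :
  symmetric R -> [disjoint A & B] ->
  {in A &, forall x y, x != y -> R x y} ->
  {in B &, forall x y, x != y -> R x y} ->
  a1 \in A -> a2 \in A -> b1 \in B -> b2 \in B ->
  (a1 == a2) = (#|A| == 1) -> (b1 == b2) = (#|B| == 1) ->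
  R a1 b1 -> R a2 b2 ->
  exists s, [/\ uniq s, s =i A :|: B & cycle R s].
Proof.
move=> symR dAB cA cB a1A a2A b1B b2B ea eb r1 r2.
have [s [us es ps ls]] := clique_path cA a1A a2A ea.
rewrite eq_sym in eb; have [t [ut et pt lt]] := clique_path cB b2B b1B eb.
exists ((a1 :: s) ++ b2 :: t); split.
- rewrite cat_uniq us ut andbT; apply/hasPn=> x /=; rewrite et => xB.
  by apply: contraL xB; rewrite es => xA; rewrite (disjointFr dAB xA).
- by move=> x; rewrite mem_cat es et inE.
- by rewrite /= rcons_cat cat_path ps ls /= r2 rcons_path pt lt symR r1.
Qed.

(** The last hypothesis is 2-connectedness: removing a vertex x leaves a cross
    edge unless it leaves only one clique.  If no two cross edges were disjoint,
    all of them would share an end, whose removal would leave no cross edge.  If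
    one clique is a single vertex, two cross edges at it suffice. *)
Lemma two_cliques_hamiltonian (T : finType) (R : rel T) (A B : {set T}) :
  symmetric R -> [disjoint A & B] -> 3 <= #|A :|: B| ->
  {in A &, forall x y, x != y -> R x y} ->
  {in B &, forall x y, x != y -> R x y} ->
  (forall x, A :\ x != set0 -> B :\ x != set0 ->
     exists a b, [/\ a \in A :\ x, b \in B :\ x & R a b]) ->
  exists s, [/\ uniq s, s =i A :|: B & cycle R s].
Proof.
move=> symR; wlog le : A B / #|A| <= #|B|.
  move=> W dAB c3 cA cB cross; have [le|/ltnW le] := leqP #|A| #|B|; first exact: W.
  rewrite setUC; apply: W => //; rewrite 1?disjoint_sym 1?setUC //.
  move=> x hA hB; have [b [a [? ? ?]]] := cross x hB hA.
  by exists a, b; rewrite symR.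
move=> dAB c3 cA cB cross.
have cAB : #|A :|: B| = #|A| + #|B|.
  by rewrite cardsU disjoint_setI0 // cards0 subn0.
have [A0|[a aA]] := set_0Vmem A.
  have B2 : 1 < #|B| by rewrite -(set0U B) -A0; lia.
  have /card_gt1P[x [y [xB yB xy]]] := B2.
  have [|s [us es ps ls]] := @clique_path _ R B x y cB xB yB.
    by rewrite (negbTE xy) (gtn_eqF B2).
  exists (x :: s); split=> //; first by rewrite A0 set0U.
  by rewrite /= rcons_path ps ls cB // eq_sym.
have B2 : 1 < #|B| by have := cardsU1 a A; lia.
have Ax x : 1 < #|A| -> A :\ x != set0.
  by have := cardsD1 x A; rewrite -card_gt0; lia.
have Bx x : B :\ x != set0 by have := cardsD1 x B; rewrite -card_gt0; lia.
have /card_gt0P[b0 b0B] : 0 < #|B| by lia.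
have Ab x : x \in B -> A :\ x != set0.
  move=> xB; apply/set0Pn; exists a; rewrite !inE aA andbT.
  by apply: contraL xB => /eqP <-; rewrite (disjointFr dAB aA).
have [a1 [b1 [/setD1P[_ a1A] /setD1P[_ b1B] r1]]] := cross b0 (Ab _ b0B) (Bx _).
have [a3 [b3 [/setD1P[_ a3A] /setD1P[b31 b3B] r3]]] := cross b1 (Ab _ b1B) (Bx _).
have fin x x' y y' : x \in A -> x' \in A -> y \in B -> y' \in B ->
   (x == x') = (#|A| == 1) -> y != y' -> R x y -> R x' y' ->
   exists s, [/\ uniq s, s =i A :|: B & cycle R s].
  move=> xA xA' yB yB' ex yy; apply: link_two_cliques => //.
  by rewrite (negbTE yy) (gtn_eqF B2).
have [A1|A1] := eqVneq #|A| 1.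
  apply: (fin a3 a1 b3 b1) => //; rewrite A1 eqxx.
  by apply/eqP/(card_le1_eqP (A := mem A)) => //; rewrite A1.
have A2 : 1 < #|A| by rewrite ltn_neqAle eq_sym A1 card_gt0; apply/set0Pn; exists a.
have neqA x y : x != y -> (x == y) = (#|A| == 1).
  by move=> xy; rewrite (negbTE xy) (negbTE A1).
have [a31|a31] := eqVneq a3 a1; last by apply: (fin a3 a1 b3 b1) => //; apply: neqA.
(* Here both cross edges found so far end at a1; the next one avoids a1. *)
have [a2 [b2 [/setD1P[a21 a2A] /setD1P[_ b2B] r2]]] := cross a1 (Ax _ A2) (Bx _).
have [b21|b21] := eqVneq b2 b1; last by apply: (fin a2 a1 b2 b1) => //; apply: neqA.
by apply: (fin a2 a3 b2 b3) => //; [apply: neqA; rewrite a31 | rewrite b21 eq_sym].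
Qed.

(** * Close sets of even and odd numbers *)

Lemma size_parity_le (s : seq nat) lo hi b :
  uniq s -> lo <= hi -> odd lo = b -> odd hi = b ->
  (forall x, x \in s -> [/\ lo <= x, x <= hi & odd x = b]) ->
  (size s).*2 + lo <= hi + 2.
Proof.
move=> us le ol oh sP; pose h x := (x - lo)./2.
have h_inj : {in s &, injective h}.
  by move=> x y /sP[? ? ?] /sP[? ? ?]; rewrite /h; lia.
have : size (map h s) <= size (iota 0 (h hi).+1).
  apply: uniq_leq_size; first by rewrite map_inj_in_uniq.
  by move=> _ /mapP[x /sP[? ? _] ->]; rewrite mem_iota /h; lia.
by rewrite size_map size_iota /h; lia.
Qed.

Lemma nat_seq_bounds (s : seq nat) x0 : x0 \in s ->
  exists lo hi, [/\ lo \in s, hi \in s & forall x, x \in s -> lo <= x <= hi].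
Proof.
move=> x0s.
have ex : exists x, x \in s by exists x0.
have ub x : x \in s -> x <= \max_(y <- s) y by move=> xs; apply: leq_bigmax_seq.
exists (ex_minn ex), (ex_maxn ex ub).
case: ex_minnP => lo los loP; case: ex_maxnP => hi his hiP.
by split=> // x xs; rewrite loP ?hiP.
Qed.

(** Let e0, e1 be the extremes of s and o0, o1 those of t.  As all members of s
    have the same parity, s has at most (e1 - e0) / 2 + 1 of them, and likewise
    for t.  The sum of these bounds is
    ((e1 - o0) + (o1 - e0)) / 2 + 2 <= d + 2.  Equality forces e1 - o0 = d, so
    that d is odd, and leaves no gap in s.  If the least number of all is in s,
    as may be assumed by symmetry, then e0 < o0 and both o0 - 1 and o0 + 1
    belong to s. *)
Lemma opposite_parity_close (s t : seq nat) b d x0 y0 :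
  uniq s -> uniq t -> x0 \in s -> y0 \in t ->
  (forall x, x \in s -> odd x = b) -> (forall y, y \in t -> odd y = ~~ b) ->
  (forall x y, x \in s -> y \in t -> x <= y + d /\ y <= x + d) ->
  [\/ size s + size t <= d + 1,
      odd d /\ (exists z, [/\ z \in s, z.+1 \in t & z.+2 \in s])
    | odd d /\ (exists z, [/\ z \in t, z.+1 \in s & z.+2 \in t])].
Proof.
wlog: s t b x0 y0 / exists2 e, e \in s & forall y, y \in t -> e <= y.
  move=> W us ut sx ty sb tb st.
  have [e [e' [es _ eP]]] := nat_seq_bounds sx.
  have [o [o' [ot _ oP]]] := nat_seq_bounds ty.
  have [eo|oe] := leqP e o.
    by apply: (W s t b x0 y0) => //; exists e => // y /oP/andP[? _]; lia.
  have [|||||||y x yt xs|?|?|?] := W t s (~~ b) y0 x0.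
  - by exists o => // x /eP/andP[? _]; lia.
  - by [].
  - by [].
  - by [].
  - by [].
  - by [].
  - by move=> x /sb; rewrite negbK.
  - by have [] := st _ _ xs yt.
  - by constructor 1; lia.
  - by constructor 3.
  - by constructor 2.
move=> [e0' e0's e0'P] us ut sx ty sb tb st.
have [e0 [e1 [e0s e1s eP]]] := nat_seq_bounds sx.
have [o0 [o1 [o0t o1t oP]]] := nat_seq_bounds ty.
have [oe0 oe1] := (sb _ e0s, sb _ e1s); have [oo0 oo1] := (tb _ o0t, tb _ o1t).
have [d1 _] := st _ _ e1s o0t; have [_ d2] := st _ _ e0s o1t.
have e01 : e0 <= e1 by have /andP[] := eP _ e1s.
have o01 : o0 <= o1 by have /andP[] := oP _ o1t.
have eo : e0 < o0.
  rewrite ltn_neqAle (leq_trans _ (e0'P _ o0t)); last by have /andP[] := eP _ e0's.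
  by rewrite andbT; apply/eqP => E; move: oe0; rewrite E oo0; case: (b).
have ct : (size t).*2 + o0 <= o1 + 2.
  apply: (@size_parity_le _ _ _ (~~ b)) => // y yt.
  by have /andP[] := oP _ yt; rewrite tb.
(* A gap z in s could be added to s without changing its extremes. *)
have bound z : z \notin s -> e0 <= z <= e1 -> odd z = b ->
    size s + size t <= d + 1.
  move=> zs /andP[z0 z1] zb.
  have : (size (z :: s)).*2 + e0 <= e1 + 2.
    apply: (@size_parity_le _ _ _ b); rewrite /= ?zs // => x.
    by rewrite inE => /predU1P[-> //|xs]; have /andP[] := eP _ xs; rewrite sb.
  move: ct d1 d2 => /=; clear; lia.
have cs : (size s).*2 + e0 <= e1 + 2.
  apply: (@size_parity_le _ _ _ b) => // y ys.
  by have /andP[] := eP _ ys; rewrite sb.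
have [|big] := leqP (size s + size t) (d + 1); first by constructor 1.
have e1E : e1 = o0 + d by move: cs ct d1 d2 big; clear; lia.
have od : odd d.
  by move: oe1; rewrite e1E oddD oo0; case: (b); case: (odd d).
have d0 : 0 < d by case: (d) od.
constructor 2; split=> //; case: o0 => // o0 in o0t oP oo0 o01 d1 eo ct e1E *.
exists o0; split=> //.
  apply: contraLR big => /bound; rewrite -leqNgt; apply.
    by move: eo e1E d0; clear; lia.
  by move: oo0 => /=; case: odd; case: (b).
apply: contraLR big => /bound; rewrite -leqNgt; apply.
  by move: eo e1E d0; clear; lia.
by move: oo0 => /=; case: odd; case: (b).
Qed.

(** * The thinned circulant graph *)

(** The number of steps from x forward to y around a circle of n points; the
    value for x = y is n, not 0, so that no point is a short step from
    itself. *)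
Definition step n x y := if x < y then y - x else y + n - x.

(** For odd d the chords of length 1 are restricted to the pairs {2i, 2i + 1}
    with 2i + 1 < n.  They form a maximum matching, so that every degree is at
    most d and at most one vertex has smaller degree. *)
Definition chord n d x y :=
  [&& odd (step n x y), step n x y <= d &
      (step n x y == 1) && odd d ==> ~~ odd x && (x < y)].

Definition circulant n d : rel 'I_n := fun x y => chord n d x y || chord n d y x.
Arguments circulant : clear implicits.

(** Among #|P| + 1 disjoint blocks of length d, one is missed by P. *)
Lemma empty_block n d (P : {set 'I_n}) : 0 < d ->
  exists2 j, j <= #|P| & forall x : 'I_n, x \in P -> x < j * d \/ j.+1 * d <= x.
Proof.
move=> d0; pose s := [seq val x %/ d | x in P].
have [j ji js] : exists2 j, j \in iota 0 #|P|.+1 & j \notin s.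
  apply/hasP; rewrite has_predC; apply/negP => /allP sub.
  have := uniq_leq_size (iota_uniq 0 #|P|.+1) sub.
  by rewrite size_iota size_image ltnn.
exists j; first by rewrite mem_iota in ji; lia.
move=> x xP; have nj : val x %/ d != j.
  by apply: contraNneq js => <-; apply/imageP; exists x.
by rewrite -ltn_divLR // -leq_divRL //; lia.
Qed.

(** Position on the line obtained by cutting the circle at the block
    [j d, (j + 1) d) and starting just after it. *)
Definition cut n d j x := if x < j * d then x + n - j.+1 * d else x - j.+1 * d.

Lemma cut_inj n d j (P : {set 'I_n}) : j.+1 * d <= n ->
  (forall x : 'I_n, x \in P -> x < j * d \/ j.+1 * d <= x) ->
  {in P &, injective (fun x : 'I_n => cut n d j x)}.
Proof.
rewrite /cut mulSn; set q := j * d => qn av x y /av xq /av yq.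
have := ltn_ord x; have := ltn_ord y => yn xn E; apply: val_inj => /=.
by move: E; do !case: ifP; lia.
Qed.

(** A chord is too short to jump over the empty block, so along it the position
    grows by exactly its length. *)
Lemma chord_cut n d j (x y : 'I_n) : j.+2 * d <= n -> 0 < d ->
  x < j * d \/ j.+1 * d <= x -> y < j * d \/ j.+1 * d <= y ->
  chord n d x y -> cut n d j y = cut n d j x + step n x y.
Proof.
rewrite /chord /cut /step !mulSn; set q := j * d => qn d0 xq yq /and3P[_ + _].
have := ltn_ord x; have := ltn_ord y => yn xn.
by do !case: ifP; lia.
Qed.

Lemma chord_odd n d x y : chord n d x y -> odd (step n x y) /\ step n x y <= d.
Proof. by case/and3P. Qed.

(** If E and O were completely joined, their positions would contradict
    [opposite_parity_close]: its first case by cardinality, the other two since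
    chords of length 1 form a matching when d is odd. *)
Lemma circulant_cross n d j (P E O : {set 'I_n}) :
  0 < d -> j.+2 * d <= n ->
  (forall x : 'I_n, x \in P -> x < j * d \/ j.+1 * d <= x) ->
  E \subset [set x in P | ~~ odd (cut n d j x)] ->
  O \subset [set x in P | odd (cut n d j x)] ->
  E != set0 -> O != set0 -> d + 2 <= #|E| + #|O| ->
  exists e o, [/\ e \in E, o \in O & ~~ circulant n d e o].
Proof.
move=> d0 jn av /subsetP EP /subsetP OP /set0Pn[e0 e0E] /set0Pn[o0 o0O] big.
pose pos (x : 'I_n) := cut n d j x.
have {}EP x : x \in E -> x \in P /\ odd (pos x) = false.
  by move/EP; rewrite inE => /andP[-> /negbTE].
have {}OP x : x \in O -> x \in P /\ odd (pos x) = true.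
  by move/OP; rewrite inE => /andP[-> ->].
have pos_inj : {in P &, injective pos}.
  by apply: cut_inj => //; move: jn; rewrite !mulSn; lia.
have arcP x y : x \in P -> y \in P -> chord n d x y -> pos y = pos x + step n x y.
  by move=> xP yP; apply: chord_cut => //; apply: av.
have [/existsP[e /existsP[o /and3P[? ? ?]]]|none] :=
    boolP [exists e, exists o, [&& e \in E, o \in O & ~~ circulant n d e o]].
  by exists e, o.
have adj e o : e \in E -> o \in O -> circulant n d e o.
  move=> eE oO; apply: contraNT none => h.
  by apply/existsP; exists e; apply/existsP; exists o; rewrite eE oO.
pose s := [seq pos x | x in E]; pose t := [seq pos x | x in O].
have us : uniq s.
  rewrite map_inj_in_uniq ?enum_uniq // => x y.
  by rewrite !mem_enum => /EP[? _] /EP[? _]; apply: pos_inj.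
have ut : uniq t.
  rewrite map_inj_in_uniq ?enum_uniq // => x y.
  by rewrite !mem_enum => /OP[? _] /OP[? _]; apply: pos_inj.
have sP x : x \in s -> exists2 e, e \in E & x = pos e by case/imageP=> e; exists e.
have tP x : x \in t -> exists2 o, o \in O & x = pos o by case/imageP=> e; exists e.
(* Three consecutive positions cannot be joined in a row: both chords would
   have length 1, so that x and y = x + 1 would both be even. *)
have middle x y z : odd d -> x \in P -> y \in P -> z \in P ->
    pos y = (pos x).+1 -> pos z = (pos x).+2 ->
    circulant n d x y -> circulant n d y z -> False.
  move=> dd xP yP zP Ey Ez xy yz.
  have f u v : u \in P -> v \in P -> pos v = (pos u).+1 -> circulant n d u v ->
      [/\ ~~ odd u, u < v & v = u.+1 :> nat].
    move=> uP vP Ev /orP[] a; have := arcP _ _ _ _ a.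
      move=> /(_ uP vP) Es; have s1 : step n u v = 1 by move: Es Ev; clear; lia.
      move: a; rewrite /chord s1 dd /= => /and3P[_ -> uv]; split=> //.
      by move: s1; rewrite /step uv; move: uv; clear; lia.
    by move=> /(_ vP uP); move: Ev; clear; lia.
  have [xev _ E1] := f _ _ xP yP Ey xy.
  have [] := f _ _ yP zP _ yz; first by rewrite Ey.
  by rewrite E1 /= xev.
have := @opposite_parity_close s t false d (pos e0) (pos o0) us ut.
case.
- by apply: image_f.
- by apply: image_f.
- by move=> _ /sP[e /EP[_ ?] ->].
- by move=> _ /tP[e /OP[_ ?] ->].
- move=> _ _ /sP[e eE ->] /tP[o oO ->].
  have [eP _] := EP _ eE; have [oP _] := OP _ oO.
  case/orP: (adj _ _ eE oO) => a; have [_ le] := chord_odd a.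
    by have := arcP _ _ eP oP a; move: le; clear; lia.
  by have := arcP _ _ oP eP a; move: le; clear; lia.
- by rewrite !size_image => /(leq_trans big); clear; lia.
- case=> dd [_ [/sP[x xE ->] /tP[y yO Ey] /sP[z zE Ez]]].
  have [? _] := EP _ xE; have [? _] := OP _ yO; have [? _] := EP _ zE.
  case: (@middle x y z) => //; first exact: adj.
  by rewrite /circulant orbC; apply: adj.
- case=> dd [_ [/tP[x xE ->] /sP[y yO Ey] /tP[z zE Ez]]].
  have [? _] := OP _ xE; have [? _] := EP _ yO; have [? _] := OP _ zE.
  case: (@middle x y z) => //; last exact: adj.
  by rewrite /circulant orbC; apply: adj.
Qed.

Lemma circulant_sym n d : symmetric (circulant n d).
Proof. by move=> x y; rewrite /circulant orbC. Qed.

(** Positions of the same parity are not joined by H, so the two parity classes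
    of P are cliques of the complement.  Removing one of the d + 3 vertices
    leaves d + 2, enough for [circulant_cross] to provide a cross edge. *)
Lemma circulant_co_hamiltonian n d (P : {set 'I_n}) :
  0 < d -> #|P| = d + 3 -> (d + 5) * d <= n ->
  exists s, [/\ uniq s, s =i P & cycle (fun x y => ~~ circulant n d x y) s].
Proof.
move=> d0 cP nbig; have [j jP av] := empty_block P d0.
have jn : j.+2 * d <= n by apply: leq_trans nbig; rewrite leq_pmul2r //; lia.
pose E := [set x in P | ~~ odd (cut n d j x)].
pose O := [set x in P | odd (cut n d j x)].
have EO : E :|: O = P by apply/setP=> x; rewrite !inE -andb_orr orNb andbT.
have dEO : [disjoint E & O].
  by rewrite -setI_eq0; apply/eqP/setP=> x; rewrite !inE; case: odd; rewrite ?andbF.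
have same x y : x \in P -> y \in P -> odd (cut n d j x) = odd (cut n d j y) ->
    ~~ circulant n d x y.
  move=> xP yP par; apply/negP => /orP[] a; have [o _] := chord_odd a.
    by have := chord_cut jn d0 (av _ xP) (av _ yP) a; lia.
  by have := chord_cut jn d0 (av _ yP) (av _ xP) a; lia.
have := @two_cliques_hamiltonian _ (fun x y => ~~ circulant n d x y) E O.
rewrite EO; apply=> //.
- by move=> x y; rewrite circulant_sym.
- by rewrite cP; lia.
- by move=> x y; rewrite !inE => /andP[? /negbTE ex] /andP[? /negbTE ey] _; apply: same; rewrite ?ex.
- by move=> x y; rewrite !inE => /andP[? ex] /andP[? ey] _; apply: same; rewrite ?ex.
move=> x E0 O0.
have [|||||e [o [? ? ?]]] := @circulant_cross n d j P (E :\ x) (O :\ x) d0 jn av.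
- exact: subD1set.
- exact: subD1set.
- by [].
- by [].
- have : #|P| = #|E| + #|O| by rewrite -EO cardsU disjoint_setI0 // cards0 subn0.
  have : (x \in E) + (x \in O) <= 1.
    case xE: (x \in E); last by case: (x \in O).
    by rewrite (disjointFr dEO xE).
  move=> x1 card; have := cP; rewrite card (cardsD1 x E) (cardsD1 x O).
  by rewrite addnACA; set a := _ + _ in x1 *; set c := _ + #|_|; move: x1; clear; lia.
- by exists e, o.
Qed.

Definition chords n d : {set 'I_n * 'I_n} := [set q : 'I_n * 'I_n | chord n d q.1 q.2].

Definition circulant_edges n d : {set {set complete n}} :=
  [set [set q.1; q.2] | q : 'I_n * 'I_n in chords n d].

(** Each vertex x is the start of chords of d / 2 admissible lengths, namely
    1, 3, 5, ... for even d and 3, 5, 7, ... for odd d; in the odd case the n / 2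
    matching chords come in addition. *)
Lemma card_chords n d : 0 < d -> 2 * d < n -> (d * n) %/ 2 <= #|chords n d|.
Proof.
move=> d0 dn; have n0 : 0 < n by lia.
pose I := (('I_n * 'I_(d./2)) + 'I_(odd d * n./2))%type.
pose k (i : nat) := i.*2.+1 + (odd d).*2.
pose f (u : I) : 'I_n * 'I_n := match u with
  | inl (x, i) => (x, Ordinal (ltn_pmod (x + k i) n0))
  | inr i => (Ordinal (ltn_pmod i.*2 n0), Ordinal (ltn_pmod i.*2.+1 n0))
  end.
have kd (i : 'I_(d./2)) : k i <= d.
  by rewrite /k; have := ltn_ord i; move: (nat_of_ord i) => {}i; case E: (odd d); lia.
have stepl (x : 'I_n) (i : 'I_(d./2)) : step n x ((x + k i) %% n) = k i.
  have := kd i; have := ltn_ord x; rewrite /step.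
  have : 0 < k i by [].
  move: (k i) => c c0 xn cd; have [lt|ge] := ltnP (x + c) n.
    by rewrite modn_small //; case: ifP; lia.
  rewrite -(subnK ge) modnDr modn_small; last by lia.
  by case: ifP; lia.
have inr_lt (i : 'I_(odd d * n./2)) : odd d /\ i.*2.+1 < n.
  by case: i => i /=; case: (odd d) => /=; lia.
have b2 : odd d -> (odd d).*2 = 2 by move=> ->.
have f_inj : injective f.
  have lr x i j : f (inl (x, i)) = f (inr j) -> False.
    have [od jn] := inr_lt j.
    case=> Ex E; have := stepl x i; rewrite E Ex /= !modn_small; try lia.
    by rewrite /step ltnSn subSnn /k (b2 od); clear; lia.
  move=> [[x i]|i] [[y j]|j].
  - move=> E; have Exy : x = y by case: E.
    subst y; congr (inl (_, _)); apply: val_inj => /=.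
    have := stepl x i; case: E => ->; rewrite stepl /k; clear; lia.
  - by move=> /lr.
  - by move=> /esym/lr.
  - have [_ ?] := inr_lt i; have [_ ?] := inr_lt j.
    case=> + _; rewrite !modn_small; try lia.
    by move=> E; congr inr; apply: val_inj => /=; lia.
have sub : [set f u | u in [set: I]] \subset chords n d.
  apply/subsetP=> _ /imsetP[[[x i]|i] _ ->]; rewrite inE /chord /=.
    rewrite stepl kd /k /=; apply/andP; split; first by rewrite oddD !odd_double.
    by apply/implyP => /andP[+ od]; rewrite od; lia.
  have [od jn] := inr_lt i.
  rewrite !modn_small; try lia.
  by rewrite /step ltnSn subSnn d0 odd_double /= implybT.
have := subset_leq_card sub.
rewrite card_imset // cardsT card_sum card_prod !card_ord => le.
apply: leq_trans le.
have := odd_double_half d; case: (odd d) => <-; rewrite ?mul1n ?mul0n; nia.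
Qed.

Lemma step_antisym n x y : x < n -> y < n -> x != y -> step n x y + step n y x = n.
Proof. by rewrite /step => *; do !case: ifP; lia. Qed.

Lemma chord_neq n d (x y : 'I_n) : d < n -> chord n d x y -> x != y.
Proof.
move=> dn; apply: contraTneq => ->; apply/negP => /chord_odd[_].
by rewrite /step ltnn addKn; lia.
Qed.

(** Chords are short steps, so an edge cannot be a chord in both directions, as
    the two steps add up to n. *)
Lemma card_circulant_edges n d : 2 * d < n -> #|circulant_edges n d| = #|chords n d|.
Proof.
move=> dn; apply: card_in_imset => -[x y] [x' y'].
rewrite !inE /= => xy xy' E.
have nxy : x != y by apply: chord_neq xy; lia.
have nxy' : x' != y' by apply: chord_neq xy'; lia.
have : x \in [set x'; y'] by rewrite -E set21.
have : y \in [set x'; y'] by rewrite -E set22.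
rewrite !inE => /pred2P[] Ey /pred2P[] Ex; subst; rewrite ?eqxx // in nxy nxy' *.
have [_ l1] := chord_odd xy; have [_ l2] := chord_odd xy'.
have := step_antisym (ltn_ord x') (ltn_ord y') nxy'; lia.
Qed.

Lemma circulant_edges_adj n d (x y : 'I_n) :
  d < n -> [set x; y] \in circulant_edges n d -> circulant n d x y.
Proof.
move=> dn /imsetP[[u v]]; rewrite inE /= => uv E.
have xy : x != y.
  by have := chord_neq dn uv; have := cards2 u v; rewrite -E cards2; do 2!case: (_ != _).
have : x \in [set u; v] by rewrite -E set21.
have : y \in [set u; v] by rewrite -E set22.
rewrite /circulant !inE => /pred2P[] Ey /pred2P[] Ex; rewrite Ex Ey ?uv ?orbT //.
  by rewrite Ex Ey eqxx in xy.
by rewrite Ex Ey eqxx in xy.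
Qed.

(** * Colorings with a single non-rainbow color *)

(** The index of an edge outside H in the enumeration of H is #|H|, so all edges
    outside H get the last color. *)
Definition rainbow n (H : {set {set complete n}}) : coloring n #|H|.+1 :=
  [ffun e => inord (index (val e) (enum H))].

Lemma rainbow_rest n (H : {set {set complete n}}) e :
  val e \notin H -> rainbow H e = ord_max.
Proof.
move=> eH; rewrite ffunE memNindex ?mem_enum // -cardE.
by apply: val_inj; rewrite /= inordK.
Qed.

Lemma rainbow_used n (H : {set {set complete n}}) (k : 'I_#|H|.+1) :
  H \subset edges (complete n) -> k < #|H| -> exists e, rainbow H e == k.
Proof.
move=> /subsetP sub kH.
have eH : nth set0 (enum H) k \in H by rewrite -mem_enum mem_nth // -cardE.
exists (exist (fun e => e \in edges (complete n)) _ (sub _ eH)).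
apply/eqP/val_inj; rewrite ffunE /=.
by rewrite index_uniq ?enum_uniq -?cardE // inord_val.
Qed.

Lemma cycle_nth (T : Type) (R : rel T) x0 (s : seq T) i :
  cycle R s -> i < size s -> R (nth x0 s i) (nth x0 s (i.+1 %% size s)).
Proof.
case: s => // x s /= /(pathP x0)/(_ i); rewrite size_rcons => cyc lt.
have := cyc lt; rewrite -rcons_cons !nth_rcons /= lt modnS_small // eqSS.
by move: lt; rewrite ltnS; case: ltngtP => // ->.
Qed.

Lemma class_adj_sym (G : sgraph) n m (c : coloring n m)
  (f : {ffun G -> complete n}) k : symmetric (class_adj c f k).
Proof. by move=> x y; apply: eq_existsb => e; rewrite setUC. Qed.

Lemma mono_hamiltonian_good n p (H : {set {set complete n}}) :
  3 <= p -> 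
  (forall P : {set 'I_n}, #|P| = p -> exists s : seq 'I_n,
     [/\ uniq s, s =i P & cycle (fun x y => [set x; y] \notin H) s]) ->
  forall f : {ffun complete p -> complete n}, injective f ->
    color_occurs (rainbow H) f ord_max &&
    supergraphs (cycle_graph p) (color_class (rainbow H) f ord_max).
Proof.
move=> p3 ham f f_inj.
pose P : {set 'I_n} := f @: setT.
have cP : #|P| = p by rewrite card_imset // cardsT card_ord.
have [s [us es cs]] := ham P cP.
have ss : size s = p by rewrite -cP -(card_uniqP us); apply: eq_card.
have p0 : 0 < p by lia.
pose i0 : 'I_p := Ordinal p0.
have [x0 _] : exists x0 : complete n, x0 \in P by exists (f i0); apply: imset_f.
pose g (i : 'I_p) : complete n := nth x0 s i.
have g_inj : injective g.
  by move=> i j /eqP; rewrite nth_uniq ?ss // => /eqP/val_inj.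
have gP i : g i \in P by rewrite -es mem_nth ?ss.
have PE (x y : complete n) : x \in P -> y \in P -> x != y -> [set x; y] \notin H ->
    class_adj (rainbow H) f ord_max x y.
  case/imsetP=> i _ -> /imsetP[j _ ->] fij xyH; apply/existsP.
  exists (exist (fun e => e \in edges (complete n)) _ (edge_complete fij)).
  rewrite /= eqxx rainbow_rest // eqxx andbT.
  apply/imsetP; exists [set i; j]; last by rewrite imsetU1 imset_set1.
  by apply: edge_complete; apply: contraNneq fij => ->.
have succ (i j : 'I_p) : i != j -> j = i.+1 %% p :> nat ->
    class_adj (rainbow H) f ord_max (g i) (g j).
  move=> ij ji; apply: PE => //; first by rewrite (inj_eq g_inj).
  by have := cycle_nth x0 (i := i) cs; rewrite ss /g ji; apply.
have adj (i j : 'I_p) : cycle_rel i j -> class_adj (rainbow H) f ord_max (g i) (g j).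
  case/andP=> ij /orP[] /eqP; first exact: succ.
  by move=> /succ; rewrite eq_sym ij => /(_ isT); rewrite class_adj_sym.
have nbr (i : 'I_p) : [exists y, class_adj (rainbow H) f ord_max (g i) y].
  apply/existsP; exists (g (ordS i)); apply: adj.
  by rewrite /cycle_rel /= eqxx andbT ordS_neq //; lia.
apply/andP; split.
  have /existsP[y /existsP[e /and3P[_ eC ek]]] := nbr i0.
  by apply/existsP; exists e; rewrite eC.
pose h : {ffun cycle_graph p -> color_class (rainbow H) f ord_max} :=
  [ffun i : 'I_p => exist _ (g i) (nbr i)].
apply/existsP; exists h; apply/andP; split.
  by apply/injectiveP => i j; rewrite !ffunE => /(congr1 val)/g_inj.
by apply/forallP=> i; apply/forallP=> j; apply/implyP => ij; rewrite !ffunE; apply: adj.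
Qed.

Lemma attainable_circulant n p :
  5 <= p -> (p + 2) * p < n ->
  exists2 m, ((p - 3) * n) %/ 2 + 1 <= m &
    attainable n (complete p) (supergraphs (cycle_graph p)) m.
Proof.
move=> p5 nbig; pose d := p - 3; pose H := circulant_edges n d.
have d0 : 0 < d by rewrite /d; lia.
have dn : (d + 5) * d <= n.
  by apply: leq_trans (ltnW nbig); apply: leq_mul; rewrite /d; lia.
have dn2 : 2 * d < n.
  by apply: leq_ltn_trans nbig; apply: leq_mul; rewrite /d; lia.
have ham (P : {set 'I_n}) : #|P| = p -> exists s : seq 'I_n,
    [/\ uniq s, s =i P & cycle (fun x y => [set x; y] \notin H) s].
  move=> cP; have [|s [us es cs]] := circulant_co_hamiltonian d0 (P := P) _ dn.
    by rewrite cP /d; lia.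
  exists s; split=> //; apply: sub_cycle cs => x y; apply: contra.
  by apply: circulant_edges_adj; lia.
have good := mono_hamiltonian_good (ltnW (ltnW p5)) ham.
exists #|H|.+1.
  by rewrite addn1 ltnS card_circulant_edges // card_chords.
apply/existsP; exists (rainbow H); apply/andP; split; last first.
  apply/forallP=> f; apply/implyP => /injectiveP/good occ.
  by apply/existsP; exists ord_max.
apply/forallP=> k; apply/existsP.
have := ltn_ord k; rewrite ltnS leq_eqVlt => /predU1P[kH|]; last first.
  apply: rainbow_used; apply/subsetP=> _ /imsetP[[x y] + ->]; rewrite inE /= => xy.
  by apply: edge_complete; apply: chord_neq xy; lia.
(* The last color occurs because it already occurs in any copy of K_p. *)
have pn : p <= n by apply: leq_trans (ltnW nbig); rewrite leq_pmull //; lia.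
pose f : {ffun complete p -> complete n} := [ffun i : 'I_p => widen_ord pn i].
have f_inj : injective f.
  by move=> i j; rewrite !ffunE => /(congr1 val) /= /val_inj.
have /andP[/existsP[e /andP[_ ek]] _] := good f f_inj; exists e.
by rewrite (eqP ek); apply/eqP/val_inj; rewrite /= kH.
Qed.

(** * The theorem *)

Theorem theorem9p36 (p : nat) (hp : 5 <= p) :
  (forall n : nat, 2 * p - 5 <= n ->
     gcol n (complete p) (supergraphs (cycle_graph p)) <= ((p - 3) * n) %/ 2 + 1)
  /\
  (exists n0 : nat, forall n : nat, n0 < n ->
     gcol n (complete p) (supergraphs (cycle_graph p)) = ((p - 3) * n) %/ 2 + 1).
Proof.
have upper n : p <= n ->
    gcol n (complete p) (supergraphs (cycle_graph p)) <= ((p - 3) * n) %/ 2 + 1.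
  move=> pn; apply/bigmax_leqP => m att.
  by apply: attainable_cycle_le att => //; apply: leq_trans hp.
split=> [n n_big|]; first by apply: upper; lia.
exists ((p + 2) * p) => n n_big; apply/eqP; rewrite eqn_leq upper /=.
  have [m le_m att] := attainable_circulant hp n_big.
  exact: leq_trans le_m (gcol_ge att).
by apply: leq_trans (ltnW n_big); rewrite leq_pmull //; lia.
Qed.
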